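(* Let $\mathbf{B}=\{z=(z_j)_{j\ge1}\in\mathbb{D}^\infty: z_j\to0\}$ be the open unit ball of $c_0$, and let $\phi=(\phi_j)_{j\ge1}:\mathbf{B}\to\mathbf{B}$ be an analytic map such that $C_\phi f=f\circ\phi$ maps $A^+(\mathbb{T}^\infty)$ into itself. Then: (a) If $\phi(z)=(\epsilon_jz_{\sigma(j)})_{j\ge1}$ for some permutation $\sigma$ of $\mathbb{N}$ and some sequence $(\epsilon_j)_{j\ge1}$ of complex numbers of modulus $1$, then $C_\phi$ is an automorphism of $A^+(\mathbb{T}^\infty)$, and it is isometric. (b) If $C_\phi$ is an automorphism of $A^+(\mathbb{T}^\infty)$ and moreover, for each $k\in\mathbb{N}$, $\phi_k(z)=z_k^{d_k}u_k(z)$ for all $z\in\mathbf{B}$, with an integer $d_k\ge1$ and an analytic function $u_k$ on $\mathbf{B}$ with $u_k(0)\ne0$, then $\phi(z)=(\epsilon_jz_j)_{j\ge1}$ for some sequence $(\epsilon_j)_{j\ge1}$ of complex numbers of modulus $1$.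
   Context: $A^+(\mathbb{T}^\infty)$ is the algebra of functions $f(z)=\sum_{\alpha}a_\alpha z^\alpha$ on $\overline{\mathbb{D}}^\infty$, where $\alpha$ ranges over finitely supported sequences $(\alpha_1,\dots,\alpha_r,0,0,\dots)$ of non-negative integers, $z^\alpha=z_1^{\alpha_1}\cdots z_r^{\alpha_r}$, and $\|f\|_{A^+(\mathbb{T}^\infty)}=\sum_\alpha|a_\alpha|<\infty$; it is a commutative unital Banach algebra under pointwise multiplication. $\mathbf{B}$ carries the sup norm of $c_0$, and analyticity is in the sense of holomorphic maps on this Banach space. An automorphism is a bijective algebra homomorphism onto $A^+(\mathbb{T}^\infty)$. *)

(* Defs.v *)
From HB Require Import structures.
From mathcomp Require Import all_boot all_order all_algebra.
From mathcomp Require Import complex.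
From mathcomp Require Import boolp classical_sets reals.

Set Implicit Arguments.
Unset Strict Implicit.
Unset Printing Implicit Defensive.

Import Order.TTheory GRing.Theory Num.Theory.
Local Open Scope ring_scope.

Section Aplus.
Variable R : realType.
Local Notation C := R[i].

Definition cabs (z : C) : R := ComplexField.Normc.normc z.

(* Points of C^N are sequences z : nat -> C (coordinates z_1, z_2, ... are
   indexed from 0 here). *)

Definition Dbar (z : nat -> C) : Prop := forall j, cabs (z j) <= 1.

Definition c0 (h : nat -> C) : Prop :=
  forall e : R, 0 < e -> exists N : nat, forall j, (N <= j)%N -> cabs (h j) < e.

Definition supn (h : nat -> C) : R := sup [set cabs (h j) | j in [set: nat]].

Definition inB (z : nat -> C) : Prop := (forall j, cabs (z j) < 1) /\ c0 z.

(* Multi-indices: finitely supported alpha = (alpha_1,...,alpha_r,0,0,...),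
   encoded canonically as the list [:: alpha_1; ...; alpha_r] without
   trailing zeros. *)
Definition mindex (s : seq nat) : bool := last 1%N s != 0%N.

Definition mono (z : nat -> C) (s : seq nat) : C :=
  \prod_(j < size s) z j ^+ nth 0%N s j.

Definition has_sumC (a : seq nat -> C) (l : C) : Prop :=
  forall e : R, 0 < e -> exists F0 : seq (seq nat), all mindex F0 /\
    forall F : seq (seq nat), uniq F -> all mindex F -> {subset F0 <= F} ->
      cabs (\sum_(s <- F) a s - l) < e.

Definition has_sumR (a : seq nat -> R) (l : R) : Prop :=
  forall e : R, 0 < e -> exists F0 : seq (seq nat), all mindex F0 /\
    forall F : seq (seq nat), uniq F -> all mindex F -> {subset F0 <= F} ->
      `|\sum_(s <- F) a s - l| < e.

Definition represents (a : seq nat -> C) (f : (nat -> C) -> C) : Prop :=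
  (exists r, has_sumR (fun s => cabs (a s)) r) /\
  forall z, Dbar z -> has_sumC (fun s => a s * mono z s) (f z).

(* f belongs to A^+(T^\infty) (only its values on \bar D^\infty matter) *)
Definition Aplus (f : (nat -> C) -> C) : Prop := exists a, represents a f.

Definition Anorm_is (f : (nat -> C) -> C) (r : R) : Prop :=
  exists a, represents a f /\ has_sumR (fun s => cabs (a s)) r.

Definition agreeD (f g : (nat -> C) -> C) : Prop := forall z, Dbar z -> f z = g z.

(* Holomorphy (Frechet complex differentiability) on the open set B of the
   Banach space c_0, for c_0-valued and for scalar-valued maps. *)
Definition holoB_map (F : (nat -> C) -> (nat -> C)) : Prop :=
  forall z, inB z -> exists L : (nat -> C) -> (nat -> C),
    (forall h, c0 h -> c0 (L h)) /\
    (forall (c : C) h k, c0 h -> c0 k ->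
        L (fun j => c * h j + k j) = (fun j => c * L h j + L k j)) /\
    (exists M : R, forall h, c0 h -> supn (L h) <= M * supn h) /\
    (forall e : R, 0 < e -> exists d : R, 0 < d /\
       forall h, c0 h -> supn h < d ->
         supn (fun j => F (fun i => z i + h i) j - F z j - L h j) <= e * supn h).

Definition holoB_fun (u : (nat -> C) -> C) : Prop :=
  forall z, inB z -> exists L : (nat -> C) -> C,
    (forall (c : C) h k, c0 h -> c0 k ->
        L (fun j => c * h j + k j) = c * L h + L k) /\
    (exists M : R, forall h, c0 h -> cabs (L h) <= M * supn h) /\
    (forall e : R, 0 < e -> exists d : R, 0 < d /\
       forall h, c0 h -> supn h < d ->
         cabs (u (fun i => z i + h i) - u z - L h) <= e * supn h).

Definition analytic_self_map (phi : (nat -> C) -> (nat -> C)) : Prop :=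
  holoB_map phi /\ forall z, inB z -> inB (phi z).

Definition Cphi_rel (phi : (nat -> C) -> (nat -> C)) (f g : (nat -> C) -> C) : Prop :=
  Aplus f /\ Aplus g /\ forall z, inB z -> g z = f (phi z).

Definition Cphi_maps_Aplus phi : Prop :=
  forall f, Aplus f -> exists g, Cphi_rel phi f g.

Definition Cphi_automorphism phi : Prop :=
  Cphi_rel phi (fun _ => 1) (fun _ => 1) /\
  (forall (c : C) f f' g g', Cphi_rel phi f g -> Cphi_rel phi f' g' ->
      Cphi_rel phi (fun z => c * f z + f' z) (fun z => c * g z + g' z) /\
      Cphi_rel phi (fun z => f z * f' z) (fun z => g z * g' z)) /\
  (forall f f' g, Cphi_rel phi f g -> Cphi_rel phi f' g -> agreeD f f') /\
  (forall g, Aplus g -> exists f, Cphi_rel phi f g).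

Definition Cphi_isometric phi : Prop :=
  forall f g r, Cphi_rel phi f g -> Anorm_is f r -> Anorm_is g r.

End Aplus.

(* Main.v *)
(* (a) f |-> f o phi permutes the monomials up to unimodular factors, and two
   members of A^+ that agree on B agree on the closed polydisc by density.

   (b) The image g = phi_k of z_k lies in A^+ with |g| <= 1, and by surjectivity
   z_k = f o phi for some f in A^+. Since 1 - m z_k is invertible in A^+ for
   |m| < 1, so is 1 - m f, whence |f| <= 1. The hypothesis phi_j = z_j^{d_j} u_j
   makes phi preserve the k-th axis, so comparing first-order terms in
   f(phi(t e_k)) = t shows that the coefficients of z_k in f and in g have
   product 1. Both are at most 1 in modulus by Bessel's inequality, hence both
   are unimodular, and Bessel's inequality for g leaves no room for any other
   coefficient: g = e z_k. *)
Require Import Defs.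
From HB Require Import structures.
From mathcomp Require Import all_boot all_order all_algebra cyclic separable cyclotomic.
From mathcomp Require Import complex.
From mathcomp Require Import boolp classical_sets reals.
From mathcomp Require Import ring lra.
Import Order.TTheory GRing.Theory Num.Theory.
Local Open Scope ring_scope.

Set Implicit Arguments.
Unset Strict Implicit.
Unset Printing Implicit Defensive.

(** * The real-valued modulus of a complex number *)

Section ComplexModulus.
Variable R : realType.
Local Notation C := R[i].
Implicit Types x y z : C.

Lemma normrE_cabs z : `|z| = (cabs z)%:C%C.
Proof. by []. Qed.

Lemma cabs_ge0 z : 0 <= cabs z.
Proof. by rewrite -ler0c -normrE_cabs. Qed.

Lemma cabs0 : cabs (0 : C) = 0.
Proof. exact: ComplexField.Normc.normc0. Qed.

Lemma cabs1 : cabs (1 : C) = 1.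
Proof. exact: ComplexField.Normc.normc1. Qed.

Lemma cabsM x y : cabs (x * y) = cabs x * cabs y.
Proof. exact: ComplexField.Normc.normcM. Qed.

Lemma cabsV x : cabs x^-1 = (cabs x)^-1.
Proof. exact: ComplexField.Normc.normcV. Qed.

Lemma cabs_eq0 z : cabs z = 0 -> z = 0.
Proof. exact: ComplexField.Normc.eq0_normc. Qed.

Lemma cabsN z : cabs (- z) = cabs z.
Proof. by apply: complexI; rewrite -!normrE_cabs normrN. Qed.

Lemma cabsD x y : cabs (x + y) <= cabs x + cabs y.
Proof. by rewrite -lecR rmorphD /= -!normrE_cabs ler_normD. Qed.

Lemma cabs_distC x y : cabs (x - y) = cabs (y - x).
Proof. by rewrite -cabsN opprB. Qed.

Lemma cabs_distD z x y : cabs (x - y) <= cabs (x - z) + cabs (z - y).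
Proof. by have := cabsD (x - z) (z - y); rewrite addrA subrK. Qed.

Lemma cabsX z n : cabs (z ^+ n) = cabs z ^+ n.
Proof. by elim: n => [|n IH]; rewrite ?expr0 ?cabs1 // !exprS cabsM IH. Qed.

Lemma cabs_real (r : R) : 0 <= r -> cabs r%:C%C = r.
Proof.
by move=> r0; apply: complexI; rewrite -normrE_cabs ger0_norm // ler0c.
Qed.

Lemma cabs_sum (T : Type) (F : seq T) (a : T -> C) :
  cabs (\sum_(s <- F) a s) <= \sum_(s <- F) cabs (a s).
Proof.
elim: F => [|s F IH]; first by rewrite !big_nil cabs0.
by rewrite !big_cons (le_trans (cabsD _ _)) // lerD2l.
Qed.

Lemma cabs_prod (T : Type) (F : seq T) (a : T -> C) :
  cabs (\prod_(s <- F) a s) = \prod_(s <- F) cabs (a s).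
Proof. exact: (big_morph (fun z : C => cabs z) cabsM cabs1). Qed.

End ComplexModulus.

(** * Unconditional sums over finite subsets of an index set *)

Section Summation.
Variable R : realType.
Local Notation C := R[i].

(** Taking [D := mindex] recovers both [has_sumC] and [has_sumR] by unfolding; the general index
    type also covers pairs of multi-indices and the exponents of a geometric series. *)
Definition has_sum (T : eqType) (D : pred T) (V : zmodType) (N : V -> R)
    (a : T -> V) (l : V) : Prop :=
  forall e : R, 0 < e -> exists F0 : seq T, all D F0 /\
    forall F : seq T, uniq F -> all D F -> {subset F0 <= F} ->
      N (\sum_(s <- F) a s - l) < e.

(** For non-negative families this amounts to summability, and it expresses absolute convergence
    without naming the sum. *)
Definition bounded_sums (T : eqType) (D : pred T) (a : T -> R) (M : R) : Prop :=
  forall F : seq T, uniq F -> all D F -> \sum_(s <- F) a s <= M.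

Lemma sum_subseq (T : eqType) (V : zmodType) (F G : seq T) (a : T -> V) :
  uniq F -> uniq G -> {subset F <= G} ->
  \sum_(s <- G) a s = \sum_(s <- F) a s + \sum_(s <- G | s \notin F) a s.
Proof.
move=> uF uG FG; rewrite (bigID (mem F)) /=; congr (_ + _).
rewrite -big_filter; apply: perm_big; apply: uniq_perm => //.
  exact: filter_uniq.
by move=> s; rewrite mem_filter; case: (boolP (s \in F)) => // /FG ->.
Qed.

Variables (T : eqType) (D : pred T).
Implicit Types (F G : seq T) (a : T -> R) (b : T -> C).

Lemma all_undup_cat F G : all D F -> all D G -> all D (undup (F ++ G)).
Proof.
by move=> DF DG; apply/allP => s; rewrite mem_undup mem_cat;
  case/orP; [apply: (allP DF) | apply: (allP DG)].
Qed.

Lemma sub_undup_catl F G : {subset F <= undup (F ++ G)}.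
Proof. by move=> s sF; rewrite mem_undup mem_cat sF. Qed.

Lemma sub_undup_catr F G : {subset G <= undup (F ++ G)}.
Proof. by move=> s sF; rewrite mem_undup mem_cat sF orbT. Qed.

Lemma ler_sum_subseq F G a : (forall s, 0 <= a s) ->
  uniq F -> uniq G -> {subset F <= G} ->
  \sum_(s <- F) a s <= \sum_(s <- G) a s.
Proof.
move=> a0 uF uG FG; rewrite (sum_subseq _ uF uG FG) lerDl.
by apply: sumr_ge0.
Qed.

Lemma has_sum_bounded a r : (forall s, 0 <= a s) ->
  has_sum D (fun x : R => `|x|) a r -> bounded_sums D a r.
Proof.
move=> a0 ar F uF DF; apply/ler_addgt0Pr => e e0.
have [F0 [DF0 H]] := ar e e0.
have := H _ (undup_uniq _) (all_undup_cat DF DF0) (@sub_undup_catr F F0).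
rewrite ltr_distl => /andP[_ /ltW]; apply: le_trans.
apply: ler_sum_subseq => //; first exact: undup_uniq.
exact: sub_undup_catl.
Qed.

Lemma bounded_sums_approx a M : (forall s, 0 <= a s) -> bounded_sums D a M ->
  exists r, bounded_sums D a r /\ forall e, 0 < e ->
    exists F0, [/\ uniq F0, all D F0 & r - e < \sum_(s <- F0) a s].
Proof.
move=> a0 aM.
pose E : set R := fun x =>
  exists F, [/\ uniq F, all D F & x = \sum_(s <- F) a s].
have E0 : has_sup E.
  split; first by exists 0; exists [::]; rewrite big_nil.
  by exists M => _ [F [uF DF ->]]; apply: aM.
exists (sup E); split.
  by move=> F uF DF; apply: sup_upper_bound => //; exists F.
move=> e e0; have [_ [F [uF DF ->]] lt] := sup_adherent e0 E0.
by exists F.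
Qed.

Lemma bounded_has_sum a M : (forall s, 0 <= a s) -> bounded_sums D a M ->
  exists r, has_sum D (fun x : R => `|x|) a r.
Proof.
move=> a0 /(bounded_sums_approx a0)[r [ar H]]; exists r => e e0.
have [F0 [uF0 DF0 lt]] := H e e0; exists F0; split=> // F uF DF F0F.
rewrite distrC ltr_distlC.
have h1 := ler_sum_subseq a0 uF0 uF F0F; have h2 := ar _ uF DF.
by apply/andP; split; lra.
Qed.

(** A finite set whose sum is within [e] of the supremum of all finite sums leaves at most [e] for
    any finite set disjoint from it. *)
Lemma bounded_sums_tail a M e : (forall s, 0 <= a s) -> bounded_sums D a M ->
  0 < e -> exists F0, [/\ uniq F0, all D F0 & forall F, uniq F -> all D F ->
    \sum_(s <- F | s \notin F0) a s <= e].
Proof.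
move=> a0 /(bounded_sums_approx a0)[r [ar H]] e0.
have [F0 [uF0 DF0 lt]] := H e e0; exists F0; split=> // F uF DF.
have := ar _ (undup_uniq _) (all_undup_cat DF0 DF).
rewrite (sum_subseq _ uF0 (undup_uniq _) (@sub_undup_catl F0 F)).
suff -> : \sum_(s <- undup (F0 ++ F) | s \notin F0) a s =
          \sum_(s <- F | s \notin F0) a s by lra.
rewrite -big_filter -[RHS]big_filter; apply: perm_big; apply: uniq_perm.
- exact/filter_uniq/undup_uniq.
- exact: filter_uniq.
by move=> s; rewrite !mem_filter mem_undup mem_cat; case: (s \in F0).
Qed.

Lemma sum_dist_tail F G b : uniq F -> uniq G -> {subset F <= G} ->
  cabs (\sum_(s <- G) b s - \sum_(s <- F) b s) <=
  \sum_(s <- G | s \notin F) cabs (b s).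
Proof.
move=> uF uG FG; rewrite (sum_subseq _ uF uG FG) addrC addKr.
by rewrite -big_filter (le_trans (cabs_sum _ _)) // big_filter.
Qed.

(** Under absolute convergence all large finite sums are close to one another, so convergence to [l]
    need only be tested on a cofinal class of finite sets, such as rectangles or initial
    segments. *)
Lemma cofinal_has_sum b M l : bounded_sums D (fun s => cabs (b s)) M ->
  (forall e F0, 0 < e -> all D F0 -> exists F,
     [/\ uniq F, all D F, {subset F0 <= F} & cabs (\sum_(s <- F) b s - l) <= e]) ->
  has_sum D (@cabs R) b l.
Proof.
(* Three errors of [e / 4], from [F] to [F0], from [F0] to [G] and from [G] to [l], keep the total
   strictly below [e]. *)
move=> bM H e e0; have e3 : 0 < e / 4 by lra.
have [F0 [uF0 DF0 tl]] := bounded_sums_tail (fun s => cabs_ge0 (b s)) bM e3.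
exists F0; split=> // F uF DF F0F.
have [G [uG DG F0G Gl]] := H _ F0 e3 DF0.
have h1 := le_trans (sum_dist_tail b uF0 uF F0F) (tl F uF DF).
have h2 := le_trans (sum_dist_tail b uF0 uG F0G) (tl G uG DG).
rewrite cabs_distC in h2.
have h3 := cabs_distD (\sum_(s <- F0) b s) (\sum_(s <- F) b s) l.
have h4 := cabs_distD (\sum_(s <- G) b s) (\sum_(s <- F0) b s) l.
lra.
Qed.

Lemma eq_has_sum (V : zmodType) (N : V -> R) (f g : T -> V) l :
  (forall s, D s -> f s = g s) -> has_sum D N f l -> has_sum D N g l.
Proof.
move=> fg H e e0; have [F0 [DF0 h]] := H e e0; exists F0; split=> // F uF DF F0F.
suff <- : \sum_(s <- F) f s = \sum_(s <- F) g s by apply: h.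
by apply: eq_big_seq => s /(allP DF)/fg.
Qed.

Lemma bounded_sums_ge0 a M : bounded_sums D a M -> 0 <= M.
Proof. by move=> aM; have := aM [::] isT isT; rewrite big_nil. Qed.

Lemma finite_support_sum (V : zmodType) (f : T -> V) s0 F : uniq F ->
  (forall s, s \in F -> s != s0 -> f s = 0) ->
  \sum_(s <- F) f s = if s0 \in F then f s0 else 0.
Proof.
move=> uF f0; case: ifP => sF.
  rewrite (bigD1_seq s0) //= big_seq_cond big1 ?addr0 // => s /andP[].
  exact: f0.
apply: big1_seq => s /andP[_ sF']; apply: f0 => //.
by apply: contraFN sF => /eqP <-.
Qed.

Lemma single_has_sum b s0 : D s0 -> (forall s, D s -> s != s0 -> b s = 0) ->
  has_sum D (@cabs R) b (b s0).
Proof.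
move=> Ds0 b0 e e0; exists [:: s0]; rewrite /= Ds0; split=> // F uF DF s0F.
rewrite (@finite_support_sum _ _ s0) // => [|s /(allP DF)]; last exact: b0.
by rewrite s0F ?inE // subrr cabs0.
Qed.

Lemma single_bounded b s0 : (forall s, D s -> s != s0 -> b s = 0) ->
  bounded_sums D (fun s => cabs (b s)) (cabs (b s0)).
Proof.
move=> b0 F uF DF; rewrite (@finite_support_sum _ _ s0) // => [|s /(allP DF) Ds /b0].
  by case: ifP => // _; apply: cabs_ge0.
by move=> ->; rewrite ?cabs0.
Qed.

Lemma has_sum_lin (c : C) b b' l l' :
  has_sum D (@cabs R) b l -> has_sum D (@cabs R) b' l' ->
  has_sum D (@cabs R) (fun s => c * b s + b' s) (c * l + l').
Proof.
move=> H H' e e0; have c0 := cabs_ge0 c; have c1 : 0 < cabs c + 1 by lra.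
(* The added 1 keeps the denominator positive when [c = 0]. *)
have e1 : 0 < e / 2 / (cabs c + 1) by rewrite !divr_gt0.
have e2 : 0 < e / 2 by lra.
have [F [DF h]] := H _ e1; have [F' [DF' h']] := H' _ e2.
exists (undup (F ++ F')); split; first exact: all_undup_cat.
move=> G uG DG FG; have {}h := h G uG DG (fun s sF => FG _ (@sub_undup_catl F F' s sF)).
have {}h' := h' G uG DG (fun s sF => FG _ (@sub_undup_catr F F' s sF)).
rewrite big_split /= -mulr_sumr opprD addrACA -mulrBr.
apply: le_lt_trans (cabsD _ _) _; rewrite cabsM.
rewrite [e]splitr ler_ltD //; move/ltW: h; rewrite ler_pdivlMr // mulrC.
by apply: le_trans; rewrite ler_wpM2r ?cabs_ge0 // lerDl.
Qed.

Lemma bounded_lin (c : C) b b' M M' :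
  bounded_sums D (fun s => cabs (b s)) M ->
  bounded_sums D (fun s => cabs (b' s)) M' ->
  bounded_sums D (fun s => cabs (c * b s + b' s)) (cabs c * M + M').
Proof.
move=> bM bM' F uF DF.
apply: (@le_trans _ _ (\sum_(s <- F) (cabs c * cabs (b s) + cabs (b' s)))).
  by apply: ler_sum => s _; rewrite -cabsM; apply: cabsD.
rewrite big_split /= -mulr_sumr; apply: lerD; last exact: bM'.
by rewrite ler_wpM2l ?cabs_ge0 //; apply: bM.
Qed.

Lemma has_sum_unique b l l' :
  has_sum D (@cabs R) b l -> has_sum D (@cabs R) b l' -> l = l'.
Proof.
move=> H H'; apply/eqP; rewrite -subr_eq0; apply/eqP/cabs_eq0/le_anti.
rewrite cabs_ge0 andbT; apply/ler_addgt0Pr => e e0; rewrite add0r.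
have e2 : 0 < e / 2 by lra.
have [F [DF h]] := H _ e2; have [F' [DF' h']] := H' _ e2.
have := h _ (undup_uniq _) (all_undup_cat DF DF') (@sub_undup_catl F F').
have := h' _ (undup_uniq _) (all_undup_cat DF DF') (@sub_undup_catr F F').
have := cabs_distD (\sum_(s <- undup (F ++ F')) b s) l l'.
rewrite (cabs_distC l (\sum_(_ <- _) _)); lra.
Qed.

(** Closed balls are closed: a bound valid for all large finite sums passes to the limit. *)
Lemma has_sum_limit_le b l c M : has_sum D (@cabs R) b l ->
  (exists F0, all D F0 /\ forall F, uniq F -> all D F -> {subset F0 <= F} ->
     cabs (\sum_(s <- F) b s - c) <= M) -> cabs (l - c) <= M.
Proof.
move=> H [F0 [DF0 h0]]; apply/ler_addgt0Pr => e e0.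
have [F [DF h]] := H _ e0.
have h1 := h _ (undup_uniq _) (all_undup_cat DF DF0) (@sub_undup_catl F F0).
have h2 := h0 _ (undup_uniq _) (all_undup_cat DF DF0) (@sub_undup_catr F F0).
have := cabs_distD (\sum_(s <- undup (F ++ F0)) b s) l c.
rewrite (cabs_distC l (\sum_(_ <- _) _)); lra.
Qed.

(** * Regrouping a sum along the finite fibres of a map *)

Variables (T' : eqType) (D' : pred T') (fib : T -> seq T') (pi : T' -> T).
Hypothesis fib_uniq : forall s, D s -> uniq (fib s).
Hypothesis fibD' : forall s, D s -> all D' (fib s).
Hypothesis fibP : forall s x, D s -> x \in fib s -> pi x = s.
Hypothesis piP : forall x, D' x -> D (pi x) && (x \in fib (pi x)).

Let big_fibres (V : zmodType) F (a : T' -> V) :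
  \sum_(s <- F) \sum_(x <- fib s) a x = \sum_(x <- flatten (map fib F)) a x.
Proof. by rewrite big_flatten big_map. Qed.

Let fibres_uniq F : uniq F -> all D F -> uniq (flatten (map fib F)).
Proof.
elim: F => //= s F IH /andP[sF uF] /andP[Ds DF].
rewrite cat_uniq fib_uniq // IH // andbT; apply/hasPn => x.
case/flattenP=> _ /mapP[t tF ->] xt; apply/negP => xs.
by move: sF; rewrite -(fibP Ds xs) (fibP (allP DF _ tF) xt) tF.
Qed.

Let fibres_all F : all D F -> all D' (flatten (map fib F)).
Proof.
move=> DF; apply/allP => x /flattenP[_ /mapP[t tF ->]].
by move=> xt; apply: (allP (fibD' (allP DF _ tF))).
Qed.

(** A finite union of fibres is a finite set of indices in [T'], and it contains [F0] as soon as it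
    includes the fibres over [map pi F0]. *)
Lemma has_sum_regroup (V : zmodType) (N : V -> R) (a : T' -> V) l :
  has_sum D' N a l -> has_sum D N (fun s => \sum_(x <- fib s) a x) l.
Proof.
move=> H e e0; have [F0 [DF0 h]] := H e e0.
exists (map pi F0); split.
  by apply/allP => _ /mapP[x /(allP DF0)/piP/andP[? _] ->].
move=> F uF DF F0F; rewrite big_fibres; apply: h.
- exact: fibres_uniq.
- exact: fibres_all.
move=> x xF0; apply/flattenP; exists (fib (pi x)).
  by apply/map_f/F0F/map_f.
by have /piP/andP[] := allP DF0 _ xF0.
Qed.

Lemma bounded_regroup (a : T' -> C) M :
  bounded_sums D' (fun x => cabs (a x)) M ->
  bounded_sums D (fun s => cabs (\sum_(x <- fib s) a x)) M.
Proof.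
move=> aM F uF DF; apply: le_trans (aM _ (fibres_uniq uF DF) (fibres_all DF)).
by rewrite -big_fibres; apply: ler_sum => s _; apply: cabs_sum.
Qed.

End Summation.

(** * Products of absolutely convergent sums *)

Section PairSums.
Variables (R : realType) (T T' : eqType) (D : pred T) (D' : pred T').
Local Notation C := R[i].
Variables (a : T -> C) (b : T' -> C) (M M' : R).
Hypothesis aM : bounded_sums D (fun s => cabs (a s)) M.
Hypothesis bM : bounded_sums D' (fun s => cabs (b s)) M'.

Let DD : pred (T * T')%type := fun x => D x.1 && D' x.2.

Let sum_rect (V : pzRingType) (f : T -> V) (g : T' -> V) P Q :
  \sum_(x <- [seq (p, q) | p <- P, q <- Q]) f x.1 * g x.2 =
  (\sum_(p <- P) f p) * (\sum_(q <- Q) g q).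
Proof.
rewrite big_allpairs mulr_suml; apply: eq_bigr => p _.
by rewrite mulr_sumr.
Qed.

Let rect_uniq (P : seq T) (Q : seq T') : uniq P -> uniq Q ->
  uniq [seq (p, q) | p <- P, q <- Q].
Proof. by move=> uP uQ; apply: allpairs_uniq => // -[? ?] [? ?]. Qed.

(** Every finite set of pairs lies in the rectangle spanned by its two projections, over which the
    sum factors. *)
Lemma bounded_pairs :
  bounded_sums DD (fun x => cabs (a x.1 * b x.2)) (M * M').
Proof.
move=> F uF DF.
pose P := undup (map fst F); pose Q := undup (map snd F).
have DP : all D P.
  by apply/allP => p; rewrite mem_undup => /mapP[x /(allP DF)/andP[? _] ->].
have DQ : all D' Q.
  by apply/allP => p; rewrite mem_undup => /mapP[x /(allP DF)/andP[_ ?] ->].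
have FPQ : {subset F <= [seq (p, q) | p <- P, q <- Q]}.
  move=> [p q] xF; apply/allpairsP; exists (p, q); split=> //=; rewrite mem_undup.
    exact: (map_f fst xF).
  exact: (map_f snd xF).
apply: (@le_trans _ _ (\sum_(x <- [seq (p, q) | p <- P, q <- Q])
    cabs (a x.1) * cabs (b x.2))).
  under eq_bigr do rewrite cabsM.
  apply: ler_sum_subseq => // [x|]; first by rewrite mulr_ge0 ?cabs_ge0.
  by rewrite rect_uniq ?undup_uniq.
rewrite (sum_rect (fun p => cabs (a p)) (fun q => cabs (b q))).
by rewrite ler_pM ?aM ?bM ?undup_uniq //; apply: sumr_ge0 => ? _; apply: cabs_ge0.
Qed.

(** Rectangles are cofinal among the finite sets of pairs, and a sum over a rectangle is a product
    of two sums. *)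
Lemma has_sum_pairs l l' :
  has_sum D (@cabs R) a l -> has_sum D' (@cabs R) b l' ->
  has_sum DD (@cabs R) (fun x => a x.1 * b x.2) (l * l').
Proof.
move=> al bl'; apply: (cofinal_has_sum bounded_pairs) => e F0 e0 DF0.
have M'0 := bounded_sums_ge0 bM; have l0 := cabs_ge0 l.
have K0 : 0 < M' + cabs l + 1 by lra.
(* The error of the product splits as (S - l) S' + l (S' - l'), of modulus at most
   [d * M' + cabs l * d]. *)
pose d := e / (M' + cabs l + 1); have d0 : 0 < d by rewrite divr_gt0.
have [P0 [DP0 hP]] := al _ d0; have [Q0 [DQ0 hQ]] := bl' _ d0.
pose P := undup (map fst F0 ++ P0); pose Q := undup (map snd F0 ++ Q0).
have DP : all D P.
  apply: all_undup_cat => //.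
  by apply/allP => p /mapP[x /(allP DF0)/andP[? _] ->].
have DQ : all D' Q.
  apply: all_undup_cat => //.
  by apply/allP => p /mapP[x /(allP DF0)/andP[_ ?] ->].
exists [seq (p, q) | p <- P, q <- Q]; split.
- by rewrite rect_uniq ?undup_uniq.
- apply/allP => x /allpairsP[[p q] [/= pP qQ ->]].
  by rewrite /DD /= (allP DP) // (allP DQ).
- move=> [p q] xF; apply/allpairsP; exists (p, q); split=> //=.
    exact/sub_undup_catl/(map_f fst xF).
  exact/sub_undup_catl/(map_f snd xF).
rewrite (sum_rect a b); set S := \sum_(p <- P) _; set S' := \sum_(p <- Q) _.
have hS : cabs (S - l) <= d.
  by apply/ltW/hP; rewrite ?undup_uniq //; apply: sub_undup_catr.
have hS' : cabs (S' - l') <= d.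
  by apply/ltW/hQ; rewrite ?undup_uniq //; apply: sub_undup_catr.
have S'M : cabs S' <= M'.
  by apply: le_trans (cabs_sum _ _) _; apply: bM; rewrite ?undup_uniq.
have -> : S * S' - l * l' = (S - l) * S' + l * (S' - l') by ring.
apply: le_trans (cabsD _ _) _; rewrite !cabsM.
have h1 : cabs (S - l) * cabs S' <= d * M' by rewrite ler_pM ?cabs_ge0.
have h2 : cabs l * cabs (S' - l') <= cabs l * d by rewrite ler_wpM2l.
have h3 : d * (M' + cabs l + 1) = e by rewrite /d divfK ?gt_eqF.
by nra.
Qed.

End PairSums.

(** * The geometric series *)

Section GeometricSums.
Variable R : realType.
Local Notation C := R[i].

Lemma geometric_bounded (q : R) : 0 <= q -> q < 1 ->
  bounded_sums xpredT (fun n : nat => q ^+ n) (1 - q)^-1.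
Proof.
move=> q0 q1 F uF _; pose m := (\max_(i <- F) i).+1.
apply: (@le_trans _ _ (\sum_(i <- iota 0 m) q ^+ i)).
  apply: ler_sum_subseq => // [n||n nF]; rewrite ?exprn_ge0 ?iota_uniq //.
  by rewrite mem_iota /= ltnS; apply: (@leq_bigmax_seq _ _ xpredT id).
have -> : iota 0 m = index_iota 0 m by rewrite /index_iota subn0.
rewrite big_mkord -[leRHS]mul1r ler_pdivlMr ?subr_gt0 //.
by rewrite mulrC -opprB mulNr -subrX1 opprB gerBl exprn_ge0.
Qed.

Lemma geometric_has_sum (x : C) : cabs x < 1 ->
  has_sum xpredT (@cabs R) (fun n : nat => x ^+ n) (1 - x)^-1.
Proof.
move=> x1; have qb := geometric_bounded (cabs_ge0 x) x1.
have xb : bounded_sums xpredT (fun n : nat => cabs (x ^+ n)) (1 - cabs x)^-1.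
  by move=> F uF DF; under eq_bigr do rewrite cabsX; apply: qb.
have nz : 1 - x != 0.
  by rewrite subr_eq0; apply: contraTneq x1 => <-; rewrite cabs1 ltxx.
apply: (cofinal_has_sum xb) => e F0 e0 _.
have nz' : 0 < cabs (1 - x).
  by rewrite lt0r cabs_ge0 andbT; apply: contra nz => /eqP/cabs_eq0/eqP.
(* The tolerance is scaled by |1 - x| because the remainder after [m] terms is x^m / (1 - x) up to
   sign. *)
have [F1 [_ _ tl]] := bounded_sums_tail (fun s => cabs_ge0 (x ^+ s)) xb (mulr_gt0 e0 nz').
pose m := (\max_(i <- F0 ++ F1) i).+1.
have mF i : i \in F0 ++ F1 -> (i < m)%N.
  by move=> h; rewrite ltnS; apply: (@leq_bigmax_seq _ _ xpredT id).
exists (iota 0 m); split; rewrite ?iota_uniq //; first exact/allP.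
  by move=> i iF; rewrite mem_iota /= mF // mem_cat iF.
have -> : iota 0 m = index_iota 0 m by rewrite /index_iota subn0.
rewrite big_mkord.
have -> : \sum_(i < m) x ^+ i - (1 - x)^-1 = - (x ^+ m) / (1 - x).
  apply: (mulIf nz); rewrite mulrBl mulVf // divfK //.
  by have := subrX1 x m; set S := \sum_(i < m) _ => h; rewrite -(subrK 1 (x ^+ m)) h; ring.
rewrite cabsM cabsV cabsN ler_pdivrMr //.
(* Since [m] lies outside [F1], the tail bound for the one-element set [[:: m]] bounds |x^m|. *)
have := tl [:: m] isT isT; rewrite big_mkcond big_seq1; case: ifP => // /negbFE mF1 _.
by have := mF m; rewrite ltnn mem_cat mF1 orbT => /(_ isT).
Qed.

End GeometricSums.

(** * Arithmetic of finitely supported multi-indices *)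

Section MultiIndices.
Local Open Scope nat_scope.
Implicit Types (s t p q : seq nat) (h : nat -> nat).

Fixpoint trim s : seq nat :=
  if s is x :: s' then
    if (x == 0) && (trim s' == [::]) then [::] else x :: trim s'
  else [::].

Lemma mindex_trim s : mindex (trim s).
Proof.
elim: s => //= x s; case: (trim s) => [|y t] IH /=.
  by case: eqP => //= /eqP.
by rewrite andbF.
Qed.

Lemma nth_trim s i : nth 0 (trim s) i = nth 0 s i.
Proof.
elim: s i => //= x s IH [|i]; case: ifP => [/andP[/eqP-> /eqP ts]|_] //=.
by rewrite -IH ts nth_nil.
Qed.

Lemma mindex_last s : mindex s -> s != [::] -> nth 0 s (size s).-1 != 0.
Proof. by case: s => // x s ms _; rewrite nth_last. Qed.

Lemma mindex_size s n : mindex s -> (forall i, n <= i -> nth 0 s i = 0) ->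
  size s <= n.
Proof.
move=> ms s0; rewrite leqNgt; apply/negP => lt; have s_nil : s != [::] by case: s lt {ms s0}.
by have /eqP[] := mindex_last ms s_nil; rewrite s0 //; case: (size s) lt.
Qed.

(** Without trailing zeros the length of a list is determined by its non-zero entries. *)
Lemma mindex_ext s t : mindex s -> mindex t ->
  (forall i, nth 0 s i = nth 0 t i) -> s = t.
Proof.
move=> ms mt st; have sz : size s = size t.
  apply/eqP; rewrite eqn_leq; apply/andP; split; apply: mindex_size => // i h.
    by rewrite st nth_default.
  by rewrite -st nth_default.
by apply: (eq_from_nth (x0 := 0) sz).
Qed.

Definition mkidx n h : seq nat := trim (mkseq h n).

Lemma mindex_mkidx n h : mindex (mkidx n h).
Proof. exact: mindex_trim. Qed.

Lemma nth_mkidx n h i : (forall j, n <= j -> h j = 0) ->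
  nth 0 (mkidx n h) i = h i.
Proof.
move=> h0; rewrite nth_trim; case: (ltnP i n) => [lt|ge].
  by rewrite nth_mkseq.
by rewrite nth_default ?size_mkseq // h0.
Qed.

Definition addidx p q : seq nat :=
  mkidx (maxn (size p) (size q)) (fun i => nth 0 p i + nth 0 q i).

Lemma nth_addidx p q i : nth 0 (addidx p q) i = nth 0 p i + nth 0 q i.
Proof.
by rewrite nth_mkidx // => j; rewrite geq_max => /andP[h1 h2]; rewrite !nth_default.
Qed.

Lemma leq_nth_sumn s i : nth 0 s i <= sumn s.
Proof.
elim: s i => [|x s IH] [|i] //=; first exact: leq_addr.
exact: leq_trans (IH i) (leq_addl _ _).
Qed.

Fixpoint box n m : seq (seq nat) :=
  if n is n'.+1 then [::] :: [seq x :: t | x <- iota 0 m, t <- box n' m]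
  else [:: [::]].

Lemma mem_box n m s : size s <= n -> (forall i, nth 0 s i < m) -> s \in box n m.
Proof.
elim: n s => [|n IH] [|x s] //= sn sm; rewrite inE /=.
apply/allpairsP; exists (x, s); split => //=.
  by rewrite mem_iota; apply: (sm 0).
by apply: IH => // i; apply: (sm i.+1).
Qed.

Definition pair_mindex (x : seq nat * seq nat) := mindex x.1 && mindex x.2.

(** This is the fibre of [addidx] over [s]. The search space [B] suffices because summands are no
    longer than [s] and their entries do not exceed [sumn s]. *)
Definition splittings s : seq (seq nat * seq nat) :=
  let B := box (size s) (sumn s).+1 in
  undup [seq x <- [seq (p, q) | p <- B, q <- B] |
         pair_mindex x && (addidx x.1 x.2 == s)].

Lemma splittings_sound s x :
  x \in splittings s -> pair_mindex x /\ addidx x.1 x.2 = s.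
Proof. by rewrite mem_undup mem_filter => /andP[/andP[? /eqP]]. Qed.

Lemma splittings_complete x : pair_mindex x -> x \in splittings (addidx x.1 x.2).
Proof.
case: x => p q mx; rewrite mem_undup mem_filter mx eqxx /=.
case/andP: mx => mp mq; apply/allpairsP; exists (p, q); split=> //=; apply: mem_box.
- apply: mindex_size => // i h; apply/eqP.
  by have /eqP := nth_addidx p q i; rewrite nth_default // eq_sym addn_eq0 => /andP[].
- move=> i; rewrite ltnS; apply: leq_trans (leq_nth_sumn _ i).
  by rewrite nth_addidx leq_addr.
- apply: mindex_size => // i h; apply/eqP.
  by have /eqP := nth_addidx p q i; rewrite nth_default // eq_sym addn_eq0 => /andP[].
move=> i; rewrite ltnS; apply: leq_trans (leq_nth_sumn _ i).
by rewrite nth_addidx leq_addl.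
Qed.

(** The map [rho] is meant to be the inverse of [rho']. The first argument of [mkidx] is a crude
    length exceeding [rho j] for every position [j] of [s], so it covers the support. *)
Definition permidx (rho rho' : nat -> nat) s : seq nat :=
  mkidx (\sum_(j < size s) (rho j).+1) (fun i => nth 0 s (rho' i)).

Lemma nth_permidx rho rho' s i : cancel rho' rho ->
  nth 0 (permidx rho rho' s) i = nth 0 s (rho' i).
Proof.
move=> rK; rewrite nth_mkidx // => j hj; apply: nth_default.
rewrite leqNgt; apply/negP => lt; move: hj; rewrite leqNgt => /negP[].
by rewrite (bigD1 (Ordinal lt)) //= rK addSn ltnS leq_addr.
Qed.

Lemma permidxK rho rho' s : cancel rho rho' -> cancel rho' rho -> mindex s ->
  permidx rho rho' (permidx rho' rho s) = s.
Proof.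
move=> rK r'K ms; apply: mindex_ext => //; first exact: mindex_mkidx.
by move=> i; rewrite !nth_permidx // r'K.
Qed.

Definition singleidx k n : seq nat := mkidx k.+1 (fun i => if i == k then n else 0).

Lemma nth_singleidx k n i : nth 0 (singleidx k n) i = if i == k then n else 0.
Proof. by rewrite nth_mkidx // => j; case: eqP => // ->; rewrite ltnn. Qed.

(** The integer whose base-[N] digits are the entries of [s], lowest first; it determines a
    multi-index whose entries are all below [N]. *)
Fixpoint kronecker N s : nat :=
  if s is x :: s' then x + N * kronecker N s' else 0.

Lemma nth_kronecker N s j : (forall i, nth 0 s i < N) ->
  nth 0 s j = (kronecker N s %/ N ^ j) %% N.
Proof.
move=> sN; have N0 : 0 < N by apply: leq_ltn_trans (sN 0).
elim: s j sN => [|x s IH] j sN /=; first by rewrite nth_nil div0n mod0n.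
have xN : x < N by apply: (sN 0).
case: j => [|j] /=.
  by rewrite expn0 divn1 mulnC addnC modnMDl modn_small.
rewrite IH => [|i]; last exact: (sN i.+1).
by rewrite expnS divnMA mulnC addnC divnMDl // (divn_small xN) addn0.
Qed.

End MultiIndices.

(** * Monomials and their behaviour under substitutions *)

Section Monomials.
Variable R : realType.
Local Notation C := R[i].
Implicit Types (z w : nat -> C) (s p q : seq nat).

(** Frees the product from the length of [s], so that several monomials can be compared over one
    common list of positions. *)
Lemma mono_support z s (r : seq nat) : uniq r ->
  (forall i, nth 0%N s i != 0%N -> i \in r) ->
  mono z s = \prod_(i <- r) z i ^+ nth 0%N s i.
Proof.
have drop0 (u : seq nat) : \prod_(i <- u) z i ^+ nth 0%N s i =
    \prod_(i <- u | nth 0%N s i != 0%N) z i ^+ nth 0%N s i.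
  by rewrite [RHS]big_mkcond; apply: eq_bigr => i _; case: eqP => //= ->; rewrite expr0.
move=> ur sr; rewrite /mono -(big_mkord xpredT (fun j => z j ^+ nth 0%N s j)).
rewrite drop0 [RHS]drop0 -big_filter -[RHS]big_filter; apply: perm_big.
apply: uniq_perm; [exact/filter_uniq/iota_uniq | exact: filter_uniq |].
move=> i; rewrite !mem_filter; case: eqP => //= /eqP si; rewrite (sr _ si).
rewrite mem_index_iota /= ltnNge; apply/negP => h.
by move: si; rewrite nth_default.
Qed.

Lemma mono_addidx z p q : mono z (addidx p q) = mono z p * mono z q.
Proof.
have nth_mem (s : seq nat) n i : (size s <= n)%N -> nth 0%N s i != 0%N -> i \in iota 0 n.
  move=> sn; rewrite mem_iota /=; apply: contraTT; rewrite -leqNgt => h.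
  by rewrite nth_default // (leq_trans sn).
pose n := maxn (size p) (size q).
rewrite !(mono_support _ (r := iota 0 n)) ?iota_uniq //.
- by rewrite -big_split /=; apply: eq_bigr => i _; rewrite nth_addidx exprD.
- by move=> i; apply: nth_mem; apply: leq_maxr.
- by move=> i; apply: nth_mem; apply: leq_maxl.
move=> i; rewrite nth_addidx addn_eq0 negb_and; case/orP; apply: nth_mem.
  exact: leq_maxl.
exact: leq_maxr.
Qed.

Lemma mono_twist (rho rho' : nat -> nat) (d : nat -> C) z s :
  cancel rho rho' -> cancel rho' rho ->
  mono (fun j => d j * z (rho j)) s = mono d s * mono z (permidx rho rho' s).
Proof.
move=> rK r'K.
(* The support of the permuted multi-index lies in the image under [rho] of the positions of [s]. *)
rewrite (mono_support z (r := map rho (iota 0 (size s)))).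
- rewrite big_map -{1}(subn0 (size s)) big_mkord /mono -big_split /=.
  by apply: eq_bigr => i _; rewrite nth_permidx // rK exprMn.
- by rewrite map_inj_uniq ?iota_uniq //; apply: can_inj rK.
move=> i; rewrite nth_permidx // => si; rewrite -(r'K i); apply: map_f.
rewrite mem_iota /= ltnNge; apply: contra si => h; by rewrite nth_default.
Qed.

Lemma mono_singleidx z k n : mono z (singleidx k n) = z k ^+ n.
Proof.
rewrite (mono_support z (r := [:: k])) //.
  by rewrite big_seq1 nth_singleidx eqxx.
by move=> i; rewrite nth_singleidx inE; case: (i =P k).
Qed.

Lemma mono_kronecker (t : C) N s :
  mono (fun j => t ^+ (N ^ j)) s = t ^+ kronecker N s.
Proof.
elim: s t => [|x s IH] t; first by rewrite /mono big_ord0 expr0.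
rewrite /mono /= big_ord_recl /= expr1 exprD exprM -IH; congr (_ * _).
by apply: eq_bigr => i _; congr (_ ^+ _); rewrite -exprM -expnS.
Qed.

Lemma cabs_mono_le1 z s : Dbar z -> cabs (mono z s) <= 1.
Proof.
move=> Dz; rewrite cabs_prod; apply: prodr_ile1 => i _ //.
by rewrite cabs_ge0 cabsX exprn_ile1 ?cabs_ge0.
Qed.

End Monomials.

(** * The algebra of absolutely convergent power series *)

Section AplusAlgebra.
Variable R : realType.
Local Notation C := R[i].
Implicit Types (a b : seq nat -> C) (f g : (nat -> C) -> C) (z w : nat -> C).

Lemma representsP a f : represents a f <->
  (exists M, bounded_sums mindex (fun s => cabs (a s)) M) /\
  forall z, Dbar z -> has_sum mindex (@cabs R) (fun s => a s * mono z s) (f z).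
Proof.
split=> -[[M aM] af]; split=> //.
  by exists M; apply: has_sum_bounded aM => s; apply: cabs_ge0.
by apply: bounded_has_sum aM => s; apply: cabs_ge0.
Qed.

Lemma cabs_term_le a z s : Dbar z -> cabs (a s * mono z s) <= cabs (a s).
Proof. by move=> Dz; rewrite cabsM ler_piMr ?cabs_ge0 ?cabs_mono_le1. Qed.

Lemma Aplus_scaled_mono (c : C) s0 : mindex s0 -> Aplus (fun z => c * mono z s0).
Proof.
move=> ms0; pose a s := if s == s0 then c else 0.
have a0 s : mindex s -> s != s0 -> a s = 0 by rewrite /a => _ /negbTE ->.
exists a; apply/representsP; split.
  by exists (cabs (a s0)); apply: single_bounded.
move=> z Dz; have := @single_has_sum R _ mindex (fun s => a s * mono z s) s0 ms0.
rewrite {3}/a eqxx; apply => s ms ns; by rewrite a0 ?mul0r.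
Qed.

Lemma Aplus_cst (c : C) : Aplus (fun=> c).
Proof.
have -> : (fun=> c) = (fun z : nat -> C => c * mono z [::]).
  by apply: funext => z; rewrite /mono big_ord0 mulr1.
exact: Aplus_scaled_mono.
Qed.

Lemma Aplus_coord k : Aplus (fun z : nat -> C => z k).
Proof.
have -> : (fun z : nat -> C => z k) = (fun z => 1 * mono z (singleidx k 1)).
  by apply: funext => z; rewrite mono_singleidx mul1r.
exact/Aplus_scaled_mono/mindex_mkidx.
Qed.

Lemma Aplus_lin (c : C) f g : Aplus f -> Aplus g -> Aplus (fun z => c * f z + g z).
Proof.
move=> [a /representsP[[M aM] af]] [b /representsP[[M' bM] bg]].
exists (fun s => c * a s + b s); apply/representsP; split.
  by exists (cabs c * M + M'); apply: bounded_lin.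
move=> z Dz; apply: eq_has_sum (has_sum_lin c (af z Dz) (bg z Dz)) => s _.
by rewrite mulrDl mulrA.
Qed.

(** The Cauchy product: the double series over pairs of multi-indices is regrouped along the fibres
    of addition. *)
Lemma Aplus_mul f g : Aplus f -> Aplus g -> Aplus (fun z => f z * g z).
Proof.
move=> [a /representsP[[M aM] af]] [b /representsP[[M' bM] bg]].
pose add (x : seq nat * seq nat) := addidx x.1 x.2.
have uS s : mindex s -> uniq (splittings s) by rewrite undup_uniq.
have mS s : mindex s -> all pair_mindex (splittings s).
  by move=> _; apply/allP => x /splittings_sound[].
have addS s x : mindex s -> x \in splittings s -> add x = s.
  by move=> _ /splittings_sound[].
have Sadd x : pair_mindex x -> mindex (add x) && (x \in splittings (add x)).
  by move=> mx; rewrite mindex_mkidx splittings_complete.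
exists (fun s => \sum_(x <- splittings s) a x.1 * b x.2).
apply/representsP; split.
  by exists (M * M'); apply: (bounded_regroup uS mS addS (bounded_pairs aM bM)).
move=> z Dz.
have tM c N : bounded_sums mindex (fun s => cabs (c s)) N ->
    bounded_sums mindex (fun s => cabs (c s * mono z s)) N.
  move=> cN F uF mF; apply: le_trans (cN F uF mF).
  by apply: ler_sum => s _; apply: cabs_term_le.
have := has_sum_pairs (tM _ _ aM) (tM _ _ bM) (af z Dz) (bg z Dz).
move=> /(has_sum_regroup uS mS addS Sadd); apply: eq_has_sum => s ms.
rewrite mulr_suml; apply: eq_big_seq => x /(addS _ _ ms) <-.
by rewrite mono_addidx; ring.
Qed.

(** The coefficients are permuted and multiplied by unimodular numbers; the clause on norms yields
    the isometry in (a). *)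
Lemma represents_twist (rho rho' : nat -> nat) (d : nat -> C) a f :
  cancel rho rho' -> cancel rho' rho -> (forall j, cabs (d j) = 1) ->
  represents a f -> exists b,
    represents b (fun z => f (fun j => d j * z (rho j))) /\
    forall r, has_sumR (fun s => cabs (a s)) r -> has_sumR (fun s => cabs (b s)) r.
Proof.
move=> rK r'K d1 [[M aM] af].
(* Reindexing along a bijection is regrouping with one-element fibres. *)
pose fib s := [:: permidx rho' rho s]; pose pi := permidx rho rho'.
have uF s : mindex s -> uniq (fib s) by [].
have mF s : mindex s -> all mindex (fib s) by rewrite /= mindex_mkidx.
have piF s x : mindex s -> x \in fib s -> pi x = s.
  by rewrite inE => ms /eqP ->; apply: permidxK.
have Fpi x : mindex x -> mindex (pi x) && (x \in fib (pi x)).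
  by move=> mx; rewrite mindex_mkidx /fib inE /pi permidxK // eqxx.
have md1 s : cabs (mono d s) = 1.
  by rewrite cabs_prod big1 // => i _; rewrite cabsX d1 expr1n.
pose b s := a (permidx rho' rho s) * mono d (permidx rho' rho s).
have b_norm r : has_sumR (fun s => cabs (a s)) r -> has_sumR (fun s => cabs (b s)) r.
  move=> /(has_sum_regroup uF mF piF Fpi); apply: eq_has_sum => s _.
  by rewrite big_seq1 /b cabsM md1 mulr1.
exists b; split=> //; split; first by exists M; apply: b_norm.
move=> z Dz.
have Dz' : Dbar (fun j => d j * z (rho j)) by move=> j; rewrite cabsM d1 mul1r.
have := af _ Dz'; move=> /(has_sum_regroup uF mF piF Fpi).
apply: eq_has_sum => s ms; rewrite big_seq1 (mono_twist _ _ _ rK r'K) permidxK //.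
by rewrite mulrA.
Qed.

Lemma Aplus_twist (rho rho' : nat -> nat) (d : nat -> C) f :
  cancel rho rho' -> cancel rho' rho -> (forall j, cabs (d j) = 1) ->
  Aplus f -> Aplus (fun z => f (fun j => d j * z (rho j))).
Proof.
by move=> rK r'K d1 [a af]; have [b [bf _]] := represents_twist rK r'K d1 af; exists b.
Qed.

Lemma Aplus_geometric (m : C) k : cabs m < 1 ->
  Aplus (fun z => (1 - m * z k)^-1).
Proof.
(* The fibre over [s] holds the exponent n when z^s is a pure power z_k^n and is empty otherwise, so
   the coefficient of [s] is m^n or 0. *)
move=> m1; pose fib s := if s == singleidx k (nth 0%N s k) then [:: nth 0%N s k] else [::].
have uF s : mindex s -> uniq (fib s) by rewrite /fib; case: ifP.
have mF s : mindex s -> all xpredT (fib s) by rewrite /fib; case: ifP.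
have piF s x : mindex s -> x \in fib s -> singleidx k x = s.
  by rewrite /fib => _; case: ifP => // /eqP s_k; rewrite inE => /eqP ->.
have Fpi x : xpredT x -> mindex (singleidx k x) && (x \in fib (singleidx k x)).
  by rewrite mindex_mkidx /fib nth_singleidx !eqxx inE eqxx.
exists (fun s => \sum_(x <- fib s) m ^+ x); apply/representsP; split.
  exists (1 - cabs m)^-1; apply: (bounded_regroup uF mF piF).
  move=> F uF' DF; under eq_bigr do rewrite cabsX.
  exact: geometric_bounded (cabs_ge0 m) m1 F uF' DF.
move=> z Dz; have mz1 : cabs (m * z k) < 1.
  by rewrite cabsM; apply: le_lt_trans m1; rewrite ler_piMr ?cabs_ge0.
have := geometric_has_sum mz1; move=> /(has_sum_regroup uF mF piF Fpi).
apply: eq_has_sum => s ms; rewrite mulr_suml; apply: eq_big_seq => x /(piF _ _ ms) <-.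
by rewrite mono_singleidx exprMn.
Qed.

(** Monomials are bounded by 1 on the closed polydisc, so a tail of the coefficients controls the
    error uniformly in [z]. *)
Lemma represents_approx a f e : represents a f -> 0 < e ->
  exists F0, [/\ uniq F0, all mindex F0 & forall F, uniq F -> all mindex F ->
    {subset F0 <= F} -> forall z, Dbar z ->
    cabs (f z - \sum_(s <- F) a s * mono z s) <= e].
Proof.
move=> /representsP[[M aM] af] e0.
have [F0 [uF0 mF0 tl]] := bounded_sums_tail (fun s => cabs_ge0 (a s)) aM e0.
exists F0; split=> // F uF mF F0F z Dz; apply: (has_sum_limit_le (af z Dz)).
exists F; split=> // G uG mG FG; apply: le_trans (sum_dist_tail _ uF uG FG) _.
apply: le_trans (tl G uG mG); rewrite big_mkcond [leRHS]big_mkcond /=.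
apply: ler_sum => s _; case: (boolP (s \in F)) => /= sF.
  by case: ifP => // _; apply: cabs_ge0.
by rewrite (contra (F0F s) sF) cabs_term_le.
Qed.

Lemma oneB_exp_le (x : R) n : 0 <= x <= 1 -> 1 - x ^+ n <= n%:R * (1 - x).
Proof.
move=> /andP[x0 x1]; elim: n => [|n IH]; first by rewrite expr0 mul0r subrr.
have xn : x ^+ n <= 1 by rewrite exprn_ile1.
have xn0 : 0 <= x ^+ n by rewrite exprn_ge0.
by rewrite exprS -natr1; nra.
Qed.

(* A point of Dbar is approximated, coordinatewise, by its finite truncations
   multiplied by r < 1, which belong to B. *)
Lemma Aplus_le_dense f M : Aplus f -> (forall z, inB z -> cabs (f z) <= M) ->
  forall z, Dbar z -> cabs (f z) <= M.
Proof.
move=> [a af] fM z Dz; apply/ler_addgt0Pr => e e0.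
have e4 : 0 < e / 4 by lra.
have [F [uF mF approx]] := represents_approx af e4.
(* By [oneB_exp_le], scaling by 1 - t moves a monomial of degree n by at most n t, so K t bounds the
   change of the finite sum; [t] is chosen with K t <= e / 4 and t < 1. *)
pose K := \sum_(s <- F) cabs (a s) * (\sum_(j < size s) nth 0%N s j)%:R.
have K0 : 0 <= K by apply: sumr_ge0 => s _; rewrite mulr_ge0 ?cabs_ge0 ?ler0n.
have Ke : 0 < K + e / 4 + 1 by lra.
pose t := e / 4 / (K + e / 4 + 1).
have tK : t * (K + e / 4 + 1) = e / 4 by rewrite /t divfK ?gt_eqF.
have t0 : 0 < t by rewrite divr_gt0.
have t1 : t < 1 by rewrite ltr_pdivrMr //; lra.
pose n := \max_(s <- F) size s.
pose w j := if (j < n)%N then (1 - t)%:C%C * z j else 0.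
have r01 : 0 <= 1 - t by lra.
have Bw : inB w.
  split=> [j|e' e'0].
    rewrite /w; case: ifP => _; last by rewrite cabs0.
    rewrite cabsM cabs_real //; have := Dz j; have := cabs_ge0 (z j); nra.
  by exists n => j nj; rewrite /w ltnNge nj cabs0.
have Dw : Dbar w by move=> j; apply/ltW; case: Bw.
have fw := fM w Bw.
have hz := approx F uF mF (fun s => id) z Dz.
have hw := approx F uF mF (fun s => id) w Dw.
have mono_w s : s \in F -> mono w s =
    ((1 - t) ^+ (\sum_(j < size s) nth 0%N s j)%N)%:C%C * mono z s.
  move=> sF; rewrite rmorphXn /= -prodrXr -big_split /=; apply: eq_bigr => j _.
  rewrite /w (leq_trans (ltn_ord j)) ?exprMn //.
  exact: (@leq_bigmax_seq _ _ xpredT size).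
have hzw : cabs (\sum_(s <- F) a s * mono z s - \sum_(s <- F) a s * mono w s) <= e / 4.
  apply: (@le_trans _ _ (K * t)); last by nra.
  rewrite -sumrB; apply: le_trans (cabs_sum _ _) _.
  rewrite mulr_suml; rewrite big_seq [leRHS]big_seq; apply: ler_sum => s sF.
  rewrite mono_w // -mulrBr -{1}[mono z s]mul1r -mulrBl !cabsM -mulrA.
  rewrite ler_wpM2l ?cabs_ge0 //; set p := (1 - t) ^+ _.
  have p1 : p <= 1 by rewrite exprn_ile1 //; lra.
  have -> : 1 - p%:C%C = (1 - p)%:C%C :> C by rewrite rmorphB.
  rewrite cabs_real; last by lra.
  apply: (@le_trans _ _ (1 - p)); first by rewrite ler_piMr ?cabs_mono_le1 //; lra.
  have -> : t = 1 - (1 - t) by ring.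
  by apply: oneB_exp_le; apply/andP; split; lra.
have h1 := cabs_distD (\sum_(s <- F) a s * mono z s) (f z) (f w).
have h2 := cabs_distD (\sum_(s <- F) a s * mono w s) (\sum_(s <- F) a s * mono z s) (f w).
have h3 := cabsD (f z - f w) (f w).
rewrite subrK in h3; rewrite cabs_distC in hw; lra.
Qed.

Lemma Aplus_agree f g : Aplus f -> Aplus g ->
  (forall z, inB z -> f z = g z) -> agreeD f g.
Proof.
move=> Af Ag fg z Dz; apply/eqP; rewrite -subr_eq0; apply/eqP/cabs_eq0/le_anti.
rewrite cabs_ge0 andbT.
have Ah : Aplus (fun z => -1 * g z + f z) by apply: Aplus_lin.
have -> : f z - g z = -1 * g z + f z by ring.
apply: (Aplus_le_dense (M := 0) Ah) => // w Bw.
by rewrite fg // mulN1r addNr cabs0.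
Qed.

End AplusAlgebra.

(** * Roots of unity and a discrete Parseval identity *)

Lemma prim_root_exists (C : numClosedFieldType) n :
  (n > 0)%N -> exists w : C, n.-primitive_root w.
Proof.
move=> n0; have [r] := closed_field_poly_normal ('X^n - 1 : {poly C}).
rewrite (monicP _) ?monicXnsubC // scale1r => Dp.
have rn1 : all n.-unity_root r by apply/allP => z; rewrite -root_prod_XsubC -Dp.
have szr : (n < (size r).+1)%N by rewrite -(size_prod_XsubC r id) -Dp size_XnsubC.
have [|w _ wn] := hasP (has_prim_root n0 rn1 _ szr); last by exists w.
(* The polynomial X^n - 1 is separable because n is non-zero in characteristic 0, so its roots are
   distinct. *)
by rewrite -separable_prod_XsubC -Dp separable_Xn_sub_1 // pnatr_eq0 -lt0n.
Qed.

(** Expanding the squares and summing over [i] first leaves only the diagonal: the exponents [k s]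
    are distinct modulo [m], so the characters they define are orthogonal. *)
Lemma parseval_unity_roots (C : numClosedFieldType) (T : eqType) (F : seq T)
    (a : T -> C) (k : T -> nat) m (w : C) :
  m.-primitive_root w -> uniq F -> {in F, forall s, (k s < m)%N} ->
  {in F &, injective k} ->
  \sum_(i < m) `|\sum_(s <- F) a s * (w ^+ i) ^+ k s| ^+ 2 =
  m%:R * \sum_(s <- F) `|a s| ^+ 2.
Proof.
move=> wm uF km kI.
have wwJ : w * w^* = 1.
  rewrite -normCK; have /eqP := congr1 Num.norm (prim_expr_order wm).
  rewrite normrX normr1 pexpr_eq1 ?(prim_order_gt0 wm) // => /eqP ->.
  exact: expr1n.
have w0 : w != 0 by apply: contra_eq_neq wwJ => ->; rewrite mul0r eq_sym oner_neq0.
pose zeta s t := w ^+ k s * w^* ^+ k t.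
have zetam s t : zeta s t ^+ m = 1.
  have wJm : w^* ^+ m = 1 by rewrite -(rmorphXn Num.conj) (prim_expr_order wm) rmorph1.
  rewrite exprMn -!exprM ![(k _ * m)%N]mulnC !exprM (prim_expr_order wm) wJm.
  by rewrite !expr1n mulr1.
have sum_zeta s t : s \in F -> t \in F ->
    \sum_(i < m) zeta s t ^+ i = if s == t then m%:R else 0.
  move=> sF tF; case: eqP => [<-|/eqP st].
    rewrite (eq_bigr (fun=> 1)) ?sumr_const ?card_ord // => i _.
    by rewrite /zeta -exprMn wwJ !expr1n.
  (* Multiplied by [zeta s t - 1], the geometric sum telescopes to [zeta s t ^+ m - 1 = 0]; it
     remains to see that [zeta s t] differs from 1. *)
  apply: (@mulfI _ (zeta s t - 1)); last by rewrite -subrX1 zetam subrr mulr0.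
  rewrite subr_eq0; apply: contra st => /eqP zst; apply/eqP/kI => //.
  have /eqP : w ^+ k s = w ^+ k t.
    rewrite -[LHS]mulr1 -(expr1n _ (k t)) -wwJ exprMn [w ^+ k t * _]mulrC.
    by rewrite mulrA -/(zeta s t) zst mul1r.
  by rewrite (eq_prim_root_expr wm) !modn_small ?km // => /eqP.
transitivity (\sum_(i < m) \sum_(s <- F) \sum_(t <- F)
    a s * (a t)^* * zeta s t ^+ i).
  apply: eq_bigr => i _; rewrite normCK rmorph_sum /= mulr_suml.
  apply: eq_bigr => s _; rewrite mulr_sumr; apply: eq_bigr => t _.
  rewrite rmorphM /= /zeta !rmorphXn /= exprMn -!exprM ![(_ * i)%N]mulnC.
  by rewrite !exprM mulrACA.
rewrite exchange_big /= mulr_sumr; apply: eq_big_seq => s sF.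
rewrite exchange_big /= (eq_big_seq (fun t => if t == s then m%:R * `|a s| ^+ 2 else 0)).
  rewrite (@finite_support_sum _ _ _ s) ?sF ?eqxx // => t _ /negbTE -> //.
move=> t tF; rewrite -mulr_sumr sum_zeta // eq_sym; case: eqP => [->|_].
  by rewrite normCK mulrC.
by rewrite mulr0.
Qed.

(** * Bessel's inequality and expansions along a coordinate axis *)

Section Bessel.
Variable R : realType.
Local Notation C := R[i].
Implicit Types (a b : seq nat -> C) (f g : (nat -> C) -> C) (z w : nat -> C).

(* The Kronecker substitution z_j = w^(N^j) turns distinct monomials of F into
   distinct powers of w, so that Parseval over the roots of unity applies. *)
Lemma bessel_polynomial a F M : uniq F -> all mindex F ->
  (forall z, Dbar z -> cabs (\sum_(s <- F) a s * mono z s) <= M) ->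
  \sum_(s <- F) cabs (a s) ^+ 2 <= M ^+ 2.
Proof.
(* [N] exceeds every exponent, which makes [kronecker N] injective on [F]; [m] exceeds all its
   values, which stay distinct modulo [m]. *)
move=> uF mF FM; pose N := (\max_(s <- F) sumn s).+1.
pose m := (\max_(s <- F) kronecker N s).+1.
have [w wm] := @prim_root_exists C m isT.
have sN s i : s \in F -> (nth 0%N s i < N)%N.
  move=> sF; rewrite ltnS; apply: leq_trans (leq_nth_sumn s i) _.
  exact: (@leq_bigmax_seq _ _ xpredT sumn).
have km : {in F, forall s, (kronecker N s < m)%N}.
  by move=> s sF; rewrite ltnS; apply: (@leq_bigmax_seq _ _ xpredT (kronecker N)).
have kI : {in F &, injective (kronecker N)}.
  move=> s t sF tF st; apply: mindex_ext; rewrite ?(allP mF) // => i.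
  by rewrite !(@nth_kronecker N) ?st // => j; apply: sN.
have w1 : cabs w = 1.
  apply/eqP; rewrite -(@pexpr_eq1 _ _ m) ?cabs_ge0 // -cabsX.
  by rewrite (prim_expr_order wm) cabs1.
have := parseval_unity_roots a wm uF km kI.
under eq_bigr do rewrite normrE_cabs -rmorphXn /=.
under [in RHS]eq_bigr do rewrite normrE_cabs -rmorphXn /=.
rewrite -!rmorph_sum /= -(rmorph_nat (real_complex R)) -rmorphM /= => /complexI pars.
rewrite -(@ler_pM2l _ (m%:R)) ?ltr0n // -pars.
apply: (@le_trans _ _ (\sum_(i < m) M ^+ 2)); last first.
  by rewrite sumr_const card_ord mulr_natl.
apply: ler_sum => i _; rewrite lerXn2r ?nnegrE ?cabs_ge0 //.
  apply: le_trans (FM (fun=> 0) _); first exact: cabs_ge0.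
  by move=> j; rewrite cabs0.
under eq_bigr do rewrite -mono_kronecker.
by apply: FM => j; rewrite !cabsX w1 !expr1n.
Qed.

(** Large finite sums of the series are bounded by M + e on the closed polydisc, so the polynomial
    case applies to them. *)
Lemma bessel a f M : represents a f -> (forall z, Dbar z -> cabs (f z) <= M) ->
  bounded_sums mindex (fun s => cabs (a s) ^+ 2) (M ^+ 2).
Proof.
move=> af fM F uF mF; apply/ler_addgt0Pr => d d0.
have M0 : 0 <= M.
  apply: le_trans (fM (fun=> 0) _); first exact: cabs_ge0.
  by move=> j; rewrite cabs0.
have D0 : 0 < 2 * M + 1 + d by lra.
(* Then e <= 1 and e (2 M + 1) <= d, whence (M + e)^2 <= M^2 + d. *)
pose e := d / (2 * M + 1 + d); have e0 : 0 < e by rewrite divr_gt0.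
have eD : e * (2 * M + 1 + d) = d by rewrite /e divfK ?gt_eqF.
have e1 : e <= 1 by rewrite ler_pdivrMr //; lra.
apply: (@le_trans _ _ ((M + e) ^+ 2)); last by nra.
have [F0 [uF0 mF0 approx]] := represents_approx af e0.
have uG := undup_uniq (F ++ F0); have mG := all_undup_cat mF mF0.
apply: (@le_trans _ _ (\sum_(s <- undup (F ++ F0)) cabs (a s) ^+ 2)).
  apply: ler_sum_subseq => // [s|]; first by rewrite sqr_ge0.
  exact: sub_undup_catl.
apply: bessel_polynomial => // z Dz.
have := approx _ uG mG (@sub_undup_catr _ _ _) z Dz.
rewrite cabs_distC; set S := \sum_(s <- _) _ => h.
have := cabsD (S - f z) (f z); rewrite subrK; have := fM z Dz; lra.
Qed.

Definition axis k (t : C) : nat -> C := fun j => if j == k then t else 0.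

Lemma Dbar_axis k t : cabs t <= 1 -> Dbar (axis k t).
Proof. by move=> t1 j; rewrite /axis; case: ifP; rewrite ?cabs0. Qed.

Lemma inB_axis k t : cabs t < 1 -> inB (axis k t).
Proof.
move=> t1; split=> [j|e e0]; first by rewrite /axis; case: ifP; rewrite ?cabs0.
by exists k.+1 => j kj; rewrite /axis gtn_eqF ?cabs0.
Qed.

(** On the axis only powers of z_k survive, and the exponents 0 and 1 are excluded. *)
Lemma cabs_mono_axis_le k t s : cabs t <= 1 -> mindex s -> s != [::] ->
  s != singleidx k 1 -> cabs (mono (axis k t) s) <= cabs t ^+ 2.
Proof.
move=> t1 ms s_nil s_k; have t0 := cabs_ge0 t.
have [->|nz] := eqVneq (mono (axis k t) s) 0; first by rewrite cabs0 exprn_ge0.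
have off i : i != k -> nth 0%N s i = 0%N.
  move=> ik; have [lt|ge] := ltnP i (size s); last exact: nth_default.
  have /prodf_neq0/(_ (Ordinal lt) isT) := nz.
  by rewrite /= /axis (negbTE ik) expr0n; case: (nth 0%N s i) => //=; rewrite eqxx.
have sE : s = singleidx k (nth 0%N s k).
  apply: mindex_ext => // [|i]; first exact: mindex_mkidx.
  by rewrite nth_singleidx; case: (eqVneq i k) => [->|/off].
rewrite sE mono_singleidx /axis eqxx cabsX.
have n2 : (2 <= nth 0%N s k)%N.
  case def_n : (nth 0%N s k) => [|[|n]] //; rewrite def_n in sE.
    case/eqP: s_nil; rewrite sE; apply: mindex_ext => // [|i]; first exact: mindex_mkidx.
    by rewrite nth_singleidx nth_nil; case: ifP.
  by rewrite -sE eqxx in s_k.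
by rewrite -(subnK n2) exprD ler_piMl ?exprn_ge0 // exprn_ile1.
Qed.

(** A first-order Taylor expansion at 0. Each later term is at most [cabs (a s) * cabs t ^+ 2], so
    any bound on the coefficient sums serves as [K]. *)
Lemma axis_expansion a f k : represents a f -> exists K, 0 <= K /\
  forall t, cabs t <= 1 ->
    cabs (f (axis k t) - (a [::] + a (singleidx k 1) * t)) <= K * cabs t ^+ 2.
Proof.
move=> /representsP[[M aM] af]; exists M; split; first exact: bounded_sums_ge0 aM.
move=> t t1; pose F0 := [:: [::]; singleidx k 1].
have uF0 : uniq F0.
  rewrite /= inE andbT; apply/eqP => /(congr1 (fun s => nth 0%N s k)).
  by rewrite nth_singleidx eqxx nth_nil.
have mF0 : all mindex F0 by rewrite /= mindex_mkidx.
apply: (has_sum_limit_le (af _ (Dbar_axis k t1))); exists F0; split=> // F uF mF F0F.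
have -> : a [::] + a (singleidx k 1) * t = \sum_(s <- F0) a s * mono (axis k t) s.
  by rewrite big_cons big_seq1 mono_singleidx /axis eqxx /mono big_ord0 mulr1.
apply: le_trans (sum_dist_tail _ uF0 uF F0F) _.
apply: (@le_trans _ _ (\sum_(s <- F) cabs (a s) * cabs t ^+ 2)); last first.
  by rewrite -mulr_suml ler_wpM2r ?exprn_ge0 ?cabs_ge0 ?aM.
rewrite big_mkcond big_seq [leRHS]big_seq; apply: ler_sum => s sF.
case: ifP => [|_]; last by rewrite mulr_ge0 ?exprn_ge0 ?cabs_ge0.
rewrite !inE negb_or => /andP[s1 s2].
by rewrite cabsM ler_wpM2l ?cabs_ge0 // cabs_mono_axis_le // (allP mF).
Qed.

End Bessel.

(** * Composition operators: both halves of the theorem *)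

Section Composition.
Variable R : realType.
Local Notation C := R[i].
Implicit Types (phi : (nat -> C) -> (nat -> C)) (f g : (nat -> C) -> C) (z w : nat -> C).

Lemma inB_Dbar z : inB z -> Dbar z.
Proof. by case=> z1 _ j; apply/ltW. Qed.

(** The weighted permutation [P] has an inverse [Q] of the same form, and both act on the algebra by
    composition; the preimage of [g] is [g \o Q]. *)
Lemma weighted_permutation_automorphism phi (sigma : nat -> nat) (eps : nat -> C) :
  bijective sigma -> (forall j, cabs (eps j) = 1) ->
  (forall z, inB z -> phi z = (fun j => eps j * z (sigma j))) ->
  Cphi_automorphism phi /\ Cphi_isometric phi.
Proof.
case=> tau sK tK eps1 phiE.
pose P z := fun j => eps j * z (sigma j).
pose Q z := fun j => (eps (tau j))^-1 * z (tau j).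
have eps0 j : eps j != 0 by apply: contra_eq_neq (eps1 j) => ->; rewrite cabs0 eq_sym oner_eq0.
have QK z : P (Q z) = z by apply: funext => j; rewrite /P /Q sK mulVKf.
have PK z : Q (P z) = z by apply: funext => j; rewrite /P /Q tK mulKf.
have DQ z : Dbar z -> Dbar (Q z).
  by move=> Dz j; rewrite cabsM cabsV eps1 invr1 mul1r.
have AP f : Aplus f -> Aplus (f \o P) by apply: Aplus_twist sK tK eps1.
have epsV j : cabs (eps (tau j))^-1 = 1 by rewrite cabsV eps1 invr1.
have AQ f : Aplus f -> Aplus (f \o Q) by apply: Aplus_twist tK sK epsV.
(* The formula for [phi] is given on B only; density carries the identity to the closed polydisc. *)
have agreeP f g : Cphi_rel phi f g -> agreeD g (f \o P).
  move=> [Af [Ag fg]]; apply: Aplus_agree => // [|z Bz]; first exact: AP.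
  by rewrite fg // phiE.
split; last first.
  move=> f g r fg [a [af ar]]; have gfP := agreeP _ _ fg.
  have [b [bf b_norm]] := represents_twist sK tK eps1 af.
  exists b; split; last exact: b_norm.
  by case: bf => bM bf; split=> // z Dz; rewrite gfP //; apply: bf.
split; first by split; [exact: Aplus_cst | split; [exact: Aplus_cst | by []]].
split; [|split].
- move=> c f f' g g' [Af [Ag fg]] [Af' [Ag' fg']]; split.
    split; first exact: Aplus_lin.
    by split; [exact: Aplus_lin | move=> z Bz; rewrite fg // fg'].
  split; first exact: Aplus_mul.
  by split; [exact: Aplus_mul | move=> z Bz; rewrite fg // fg'].
- move=> f f' g /agreeP fg /agreeP f'g z Dz.
  rewrite -(QK z); exact: etrans (esym (fg _ (DQ _ Dz))) (f'g _ (DQ _ Dz)).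
move=> g Ag; exists (g \o Q); split; first exact: AQ.
by split=> // z Bz; rewrite phiE // -[in LHS](PK z).
Qed.

(* For |m| < 1 the function 1 - m z_k is invertible in A^+, hence so is its
   preimage 1 - m f, and f never takes the value 1 / m. *)
Lemma coord_preimage_le1 phi f k : Cphi_automorphism phi ->
  Cphi_rel phi f (fun z => z k) -> forall z, Dbar z -> cabs (f z) <= 1.
Proof.
move=> [rel1 [relA [inj surj]]] fk z Dz; rewrite leNgt; apply/negP => f1.
pose m := (f z)^-1.
have f0 : f z != 0 by apply: contraTneq f1 => ->; rewrite cabs0 ltr10.
have m1 : cabs m < 1 by rewrite cabsV invf_lt1 // (lt_trans ltr01 f1).
have [H relH] := surj _ (Aplus_geometric k m1).
have [rel_lin _] := relA (- m) _ _ _ _ fk rel1.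
have [_ [AF [AG FG]]] := relA 1 _ _ _ _ rel_lin relH.
have rel_inv : Cphi_rel phi (fun w => (- m * f w + 1) * H w) (fun=> 1).
  split=> //; split; first exact: Aplus_cst.
  move=> w Bw; rewrite -FG // mulNr addrC divff // subr_eq0.
  have mw : cabs (m * w k) < 1.
    by rewrite cabsM; apply: le_lt_trans m1; rewrite ler_piMr ?cabs_ge0 // inB_Dbar.
  by apply: contraTneq mw => <-; rewrite cabs1 ltxx.
(* By injectivity the product (1 - m f) H equals 1 on the closed polydisc, yet its first factor
   vanishes at [z]. *)
have /eqP := inj _ _ _ rel_inv rel1 z Dz.
by rewrite mulNr mulVf // addNr mul0r eq_sym oner_eq0.
Qed.

(** The vanishing condition makes [phi] map the k-th axis into itself, which reduces the comparison
    of [f] and [g] to one complex variable. *)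
Lemma diagonal_coordinate phi k : analytic_self_map phi -> Cphi_maps_Aplus phi ->
  Cphi_automorphism phi -> (forall j z, inB z -> z j = 0 -> phi z j = 0) ->
  exists e : C, cabs e = 1 /\ forall z, inB z -> phi z k = e * z k.
Proof.
move=> [_ phiB] phiA aut phi0.
have [g [_ [[b bg] gE]]] := phiA _ (Aplus_coord R k).
have [f relf] : exists f, Cphi_rel phi f (fun z => z k).
  by case: aut => _ [_ [_ surj]]; apply: surj; apply: Aplus_coord.
have f1 := coord_preimage_le1 aut relf; have [[a af] [_ fE]] := relf.
have g1 : forall z, Dbar z -> cabs (g z) <= 1.
  apply: Aplus_le_dense; first by exists b.
  by move=> z Bz; rewrite gE //; case: (phiB z Bz) => /(_ k)/ltW.
have phi_axis t : cabs t < 1 -> phi (axis k t) = axis k (g (axis k t)).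
  move=> t1; have Bt := inB_axis k t1; apply: funext => j.
  rewrite {2}/axis; case: eqP => [->|/eqP jk]; first by rewrite gE.
  by rewrite phi0 // /axis (negbTE jk).
have axis0 : axis k 0 = (fun=> 0) :> (nat -> C).
  by apply: funext => j; rewrite /axis; case: ifP.
have c0 : cabs (0 : C) < 1 by rewrite cabs0.
have g0 : g (axis k 0) = 0.
  have B0 := inB_axis k c0; by rewrite gE // phi0 // axis0.
have fg t : cabs t < 1 -> f (axis k (g (axis k t))) = t.
  move=> t1; rewrite -phi_axis // -fE; last exact: inB_axis.
  by rewrite /axis eqxx.
have f0 : f (axis k 0) = 0 by rewrite -{1}g0 fg.
have [K [K0 fK]] := axis_expansion k af; have [L [L0 gL]] := axis_expansion k bg.
have a0 : a [::] = 0.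
  have := fK 0 (ltW c0); rewrite f0 mulr0 addr0 sub0r cabsN cabs0 expr0n mulr0.
  by move=> h; apply/cabs_eq0/le_anti; rewrite cabs_ge0 andbT.
have b0 : b [::] = 0.
  have := gL 0 (ltW c0); rewrite g0 mulr0 addr0 sub0r cabsN cabs0 expr0n mulr0.
  by move=> h; apply/cabs_eq0/le_anti; rewrite cabs_ge0 andbT.
set e_k := singleidx k 1 in fK gL; have me : mindex e_k by apply: mindex_mkidx.
have bessel1 c s (h : (nat -> C) -> C) : mindex s -> represents c h ->
    (forall z, Dbar z -> cabs (h z) <= 1) -> cabs (c s) <= 1.
  move=> ms ch h1; have := bessel ch h1 (F := [:: s]) isT.
  by rewrite /= andbT big_seq1 expr1n => /(_ ms); rewrite expr_le1 ?cabs_ge0.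
have alpha1 := bessel1 _ _ _ me af f1; have beta1 := bessel1 _ _ _ me bg g1.
set alpha := a e_k in fK alpha1; set beta := b e_k in gL beta1.
(* With p = g(t e_k), both p = beta t + O(t^2) and t = alpha p + O(p^2) hold; substituting, dividing
   by t and letting t tend to 0 gives the claim. *)
have alpha_beta : alpha * beta = 1.
  apply/esym/eqP; rewrite -subr_eq0; apply/eqP/cabs_eq0/le_anti.
  rewrite cabs_ge0 andbT; apply/ler_addgt0Pr => d d0; rewrite add0r.
  (* The first term comes from |t - alpha p| <= K |p|^2 with |p| <= (1 + L) t, the second from
     |alpha| |p - beta t| <= L t^2. *)
  pose B := K * (1 + L) ^+ 2 + L.
  have B0 : 0 <= B by rewrite /B addr_ge0 // mulr_ge0 // sqr_ge0.
  have Bd : 0 < B + d + 1 by lra.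
  (* This choice ensures t < 1 and B t <= d. *)
  pose t := d / (B + d + 1); have t0 : 0 < t by rewrite divr_gt0.
  have tB : t * (B + d + 1) = d by rewrite /t divfK ?gt_eqF.
  have t1 : t < 1 by rewrite ltr_pdivrMr //; lra.
  have ct : cabs (t%:C%C : C) = t by rewrite cabs_real ?ltW.
  have T1 : cabs (t%:C%C : C) < 1 by rewrite ct.
  have := gL _ (ltW T1); set p := g _; rewrite b0 add0r ct => hp.
  have p1 : cabs p <= 1 by apply: g1; apply: Dbar_axis; apply: ltW.
  have := fK _ p1; rewrite fg // a0 add0r => hT.
  have p_le : cabs p <= (1 + L) * t.
    have := cabsD (p - beta * t%:C%C) (beta * t%:C%C).
    have t2 : L * t ^+ 2 <= L * t by rewrite ler_wpM2l // expr2 ler_piMl // ltW.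
    have bt : cabs beta * t <= t by rewrite ler_piMl // ltW.
    by rewrite subrK cabsM ct; lra.
  have pp_le : cabs p ^+ 2 <= (1 + L) ^+ 2 * t ^+ 2.
    have Lt0 : 0 <= (1 + L) * t by apply: mulr_ge0; lra.
    by rewrite -exprMn lerXn2r ?nnegrE ?cabs_ge0.
  have hB : cabs (1 - alpha * beta) * t <= B * t ^+ 2.
    rewrite -{1}ct -cabsM.
    have -> : (1 - alpha * beta) * t%:C%C =
        (t%:C%C - alpha * p) + alpha * (p - beta * t%:C%C) :> C.
      by move: (t%:C%C : C) => u; ring.
    apply: le_trans (cabsD _ _) _; rewrite (cabsM alpha) /B.
    rewrite [leRHS]mulrDl -[in leRHS]mulrA; apply: lerD.
      by apply: le_trans hT _; rewrite ler_wpM2l.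
    by apply: le_trans hp; rewrite ler_piMl ?cabs_ge0.
  have : cabs (1 - alpha * beta) <= B * t.
    by rewrite -(ler_pM2r t0) -mulrA -expr2.
  by nra.
have beta_unit : cabs beta = 1.
  have := congr1 (fun x : C => cabs x) alpha_beta; rewrite cabsM cabs1 => h.
  have := cabs_ge0 alpha; have := cabs_ge0 beta; nra.
have b_other s : mindex s -> s != e_k -> b s = 0.
  (* On this pair Bessel's inequality reads 1 + |b s|^2 <= 1. *)
  move=> ms sk; apply: cabs_eq0; have := bessel bg g1 (F := [:: e_k; s]).
  rewrite /= inE eq_sym sk me ms big_cons big_seq1 -/beta beta_unit.
  move=> /(_ isT isT) h; have := cabs_ge0 (b s); nra.
exists beta; split=> // z Bz; have Dz := inB_Dbar Bz.
rewrite -gE //; case: (bg) => _ /(_ z Dz) sum_g.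
apply: (has_sum_unique sum_g).
have -> : beta * z k = b e_k * mono z e_k by rewrite mono_singleidx.
by apply: single_has_sum => // s ms sk; rewrite b_other // mul0r.
Qed.

End Composition.

Theorem theorem14 (R : realType) (phi : (nat -> R[i]) -> (nat -> R[i]))
  (Hphi : analytic_self_map phi) (HC : Cphi_maps_Aplus phi) :
  ((exists sigma : nat -> nat, bijective sigma /\
     exists eps : nat -> R[i], (forall j, cabs (eps j) = 1) /\
       forall z, inB z -> phi z = (fun j => eps j * z (sigma j))) ->
     Cphi_automorphism phi /\ Cphi_isometric phi) /\
  (Cphi_automorphism phi ->
   (forall k : nat, exists d : nat, (1 <= d)%N /\
      exists u : (nat -> R[i]) -> R[i], holoB_fun u /\ u (fun _ => 0) != 0 /\
        forall z, inB z -> phi z k = z k ^+ d * u z) ->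
   exists eps : nat -> R[i], (forall j, cabs (eps j) = 1) /\
     forall z, inB z -> phi z = (fun j => eps j * z j)).
Proof.
split.
  move=> [sigma [sigma_bij [eps [eps1 phiE]]]].
  exact: weighted_permutation_automorphism sigma_bij eps1 phiE.
move=> aut phiE.
(* This uses d >= 1: the power [z j ^+ d] vanishes together with [z j]. *)
have phi0 j z : inB z -> z j = 0 -> phi z j = 0.
  move=> Bz zj; have [d [d1 [u [_ [_ ->]]]]] := phiE j => //.
  by rewrite zj expr0n eqn0Ngt d1 mul0r.
have [eps epsP] := choice (fun k => diagonal_coordinate k Hphi HC aut phi0).
exists eps; split=> [j|z Bz]; first by case: (epsP j).
by apply: funext => j; case: (epsP j) => _ ->.
Qed.
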